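(* Let $(M,d,0_M)$ and $(N,d,0_N)$ be complete pointed metric spaces and let $f\colon M\to N$ be a Lipschitz map with $f(0_M)=0_N$. Then the operator $\widehat f\colon\mathcal F(M)\to\mathcal F(N)$ is compact if and only if the following three conditions hold: $(P_1)$ for every bounded subset $S\subset M$, $f(S)$ is totally bounded in $N$; $(P_2)$ $f$ is uniformly locally flat, i.e. $\displaystyle\lim_{d(x,y)\to0}\frac{d(f(x),f(y))}{d(x,y)}=0$ (for every $\varepsilon>0$ there is $\delta>0$ such that $d(f(x),f(y))\le\varepsilon d(x,y)$ whenever $0<d(x,y)\le\delta$); $(P_3)$ for every sequence $(x_n,y_n)_n$ in $\widetilde M:=\{(x,y)\in M\times M: x\neq y\}$ such that $\lim_n d(x_n,0_M)=\lim_n d(y_n,0_M)=\infty$, either $(f(x_n),f(y_n))_n$ has an accumulation point in $N\times N$, or $\displaystyle\liminf_{n\to\infty}\frac{d(f(x_n),f(y_n))}{d(x_n,y_n)}=0$.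
   Context: Scalars are $\mathbb K=\mathbb R$ or $\mathbb C$. For a pointed metric space $(M,d,0_M)$, $\mathrm{Lip}_0(M)$ denotes the Banach space of Lipschitz functions $g\colon M\to\mathbb K$ with $g(0_M)=0$, normed by the best Lipschitz constant $\mathrm{Lip}(g)=\sup_{x\neq y}|g(x)-g(y)|/d(x,y)$. For $x\in M$, $\delta(x)\in\mathrm{Lip}_0(M)^*$ is the evaluation functional $\langle g,\delta(x)\rangle=g(x)$. The Lipschitz-free space $\mathcal F(M)$ is the norm-closed linear span of $\{\delta(x):x\in M\}$ in $\mathrm{Lip}_0(M)^*$; its dual is isometrically $\mathrm{Lip}_0(M)$. For a Lipschitz map $f\colon M\to N$ with $f(0_M)=0_N$, $\widehat f\colon\mathcal F(M)\to\mathcal F(N)$ is the unique bounded linear operator with $\widehat f(\delta(x))=\delta(f(x))$ for all $x\in M$ (so $\widehat f(\sum a_i\delta(x_i))=\sum a_i\delta(f(x_i))$ and $\|\widehat f\|=\mathrm{Lip}(f)$). *)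

(* Defs.v *)
From mathcomp Require Import all_boot all_order all_algebra.
From mathcomp Require Import reals.
From mathcomp.real_closed Require Import complex.
Import Order.TTheory GRing.Theory Num.Theory.

Set Implicit Arguments.
Unset Strict Implicit.
Unset Printing Implicit Defensive.

Local Open Scope ring_scope.

Section Metric.
Variables (R : realType) (M : Type) (d : M -> M -> R).

Definition is_metric : Prop :=
  [/\ (forall x y, 0 <= d x y),
      (forall x y, d x y = 0 <-> x = y),
      (forall x y, d x y = d y x) &
      (forall x y z, d x z <= d x y + d y z)].

Definition cauchy_seq (u : nat -> M) : Prop :=
  forall eps : R, 0 < eps -> exists N : nat, forall m n : nat,
    (N <= m)%N -> (N <= n)%N -> d (u m) (u n) < eps.

Definition converges_to (u : nat -> M) (l : M) : Prop :=
  forall eps : R, 0 < eps -> exists N : nat, forall n : nat,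
    (N <= n)%N -> d (u n) l < eps.

Definition complete_metric : Prop :=
  forall u : nat -> M, cauchy_seq u -> exists l, converges_to u l.

Definition bounded_set (o : M) (S : M -> Prop) : Prop :=
  exists r : R, forall x, S x -> d o x <= r.

Definition totally_bounded (S : M -> Prop) : Prop :=
  forall eps : R, 0 < eps -> exists (n : nat) (c : 'I_n -> M),
    forall x, S x -> exists i : 'I_n, d x (c i) < eps.

Definition tends_to_infty (o : M) (u : nat -> M) : Prop :=
  forall A : R, exists N : nat, forall n : nat, (N <= n)%N -> A < d (u n) o.
End Metric.

Section Maps.
Variables (R : realType) (M N : Type) (dM : M -> M -> R) (dN : N -> N -> R).

Definition lipschitz (f : M -> N) : Prop :=
  exists L : R, 0 <= L /\ forall x y, dN (f x) (f y) <= L * dM x y.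

Definition P1 (oM : M) (f : M -> N) : Prop :=
  forall S : M -> Prop, bounded_set dM oM S ->
    totally_bounded dN (fun z => exists2 x, S x & z = f x).

Definition P2 (f : M -> N) : Prop :=
  forall eps : R, 0 < eps -> exists2 delta : R, 0 < delta &
    forall x y, 0 < dM x y -> dM x y <= delta ->
      dN (f x) (f y) <= eps * dM x y.

(* (P3).  (p,q) is an accumulation point of (f x_n, f y_n)_n in N x N
   (product topology); liminf of the nonnegative ratios is 0. *)
Definition P3 (oM : M) (f : M -> N) : Prop :=
  forall x y : nat -> M,
    (forall n, x n <> y n) ->
    tends_to_infty dM oM x -> tends_to_infty dM oM y ->
    (exists p q : N, forall eps : R, 0 < eps -> forall n0 : nat,
        exists2 n : nat, (n0 <= n)%N &
          dN (f (x n)) p < eps /\ dN (f (y n)) q < eps)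
    \/
    (forall eps : R, 0 < eps -> forall n0 : nat,
        exists2 n : nat, (n0 <= n)%N &
          dN (f (x n)) (f (y n)) / dM (x n) (y n) < eps).
End Maps.

(* Lipschitz-free spaces over the scalar field K (K = R or K = R[i]),  *)
(* with emb : R -> K the canonical embedding of the reals.             *)
(* An element of Lip_0(M)^* is represented by a map phi : (M -> K) -> K; *)
(* only its values on Lip_0(M) are ever used.                          *)
Section Free.
Variables (R : realType) (K : numFieldType) (emb : R -> K).
Variables (M : Type) (d : M -> M -> R) (o : M).

Definition Lip0 (g : M -> K) : Prop :=
  g o = 0 /\ exists L : R, forall x y, `|g x - g y| <= emb (L * d x y).

Definition Lip0_ball (g : M -> K) : Prop :=
  g o = 0 /\ forall x y, `|g x - g y| <= emb (d x y).

Definition dnorm_le (phi : (M -> K) -> K) (c : R) : Prop :=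
  forall g, Lip0_ball g -> `|phi g| <= emb c.

Definition dsub (phi psi : (M -> K) -> K) : (M -> K) -> K :=
  fun g => phi g - psi g.

Definition in_dual (phi : (M -> K) -> K) : Prop :=
  (forall (a b : K) (g h : M -> K), Lip0 g -> Lip0 h ->
     phi (fun z => a * g z + b * h z) = a * phi g + b * phi h)
  /\ exists C : R, dnorm_le phi C.

Definition delta (x : M) : (M -> K) -> K := fun g => g x.

Definition in_span_delta (phi : (M -> K) -> K) : Prop :=
  exists (n : nat) (a : 'I_n -> K) (xs : 'I_n -> M),
    forall g, Lip0 g -> phi g = \sum_(i < n) a i * delta (xs i) g.

Definition in_free (phi : (M -> K) -> K) : Prop :=
  in_dual phi /\
  forall eps : R, 0 < eps -> exists2 m, in_span_delta m & dnorm_le (dsub phi m) eps.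
End Free.

Section Hat.
Variables (R : realType) (K : numFieldType) (emb : R -> K).
Variables (M N : Type) (f : M -> N).

(* widehat f : F(M) -> F(N); for phi in F(M) and g in Lip_0(N),
   <g, fhat phi> = <g o f, phi>.  In particular fhat (delta x) = delta (f x). *)
Definition fhat (phi : (M -> K) -> K) : (N -> K) -> K :=
  fun g => phi (fun x => g (f x)).

(* widehat f : F(M) -> F(N) is a compact operator: the image of the closed
   unit ball of F(M) is relatively compact in F(N), i.e. (F(N) being a
   metric space) every sequence in the unit ball of F(M) has a subsequence
   whose image converges in F(N). *)
Definition compact_hat (dM : M -> M -> R) (oM : M) (dN : N -> N -> R) (oN : N)
  : Prop :=
  forall phi : nat -> (M -> K) -> K,
    (forall n, in_free emb dM oM (phi n)) ->
    (forall n, dnorm_le emb dM oM (phi n) 1) ->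
    exists (sigma : nat -> nat) (psi : (N -> K) -> K),
      (forall n, (sigma n < sigma n.+1)%N) /\
      in_free emb dN oN psi /\
      forall eps : R, 0 < eps -> exists n0 : nat, forall n : nat, (n0 <= n)%N ->
        dnorm_le emb dN oN (dsub (fhat (phi (sigma n))) psi) eps.
End Hat.

Definition real_to_complex (R : realType) (r : R) : R[i] := (r%:C)%C.

(* Main.v *)
(** Necessity: if the operator is compact, the images of the molecules
    [(delta x - delta y) / d x y] form a totally bounded set; testing a finite
    net of them against the tent functions [max 0 (r - d w q)] yields (P1), (P2)
    and (P3).

    Sufficiency: (P1) and (P3) imply that, for every [eta > 0], the points [f x]
    and [f y] of all pairs with [d (f x) (f y) > eta * d x y] lie in a totally
    bounded set, and by (P2) such pairs are uniformly separated.  Hence, by an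
    Arzela-Ascoli argument, the functions [g o f], for [g] in the unit ball of
    Lip_0(N), form a totally bounded subset of Lip_0(M), and Schauder's argument
    transfers this to the operator itself: a diagonal subsequence of the images
    is Cauchy in norm and its pointwise limit lies in F(N). *)
Require Import Defs.
From mathcomp Require Import all_boot all_order all_algebra.
From mathcomp Require Import reals boolp classical_sets.
From mathcomp.real_closed Require Import complex.
From mathcomp Require Import ring lra.
Import Order.TTheory GRing.Theory Num.Theory.
Local Open Scope ring_scope.

(** * Sequences: greedy nets, pigeonhole and diagonal extraction *)

Lemma increasing_ge_id (sigma : nat -> nat) :
  (forall n, (sigma n < sigma n.+1)%N) -> forall n, (n <= sigma n)%N.
Proof. by move=> Hs; elim=> // n IH; apply: leq_ltn_trans (Hs n). Qed.

(** If no level had a finite net, a greedy choice would build [u] with [u n] at level [n] and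
    unrelated to all earlier terms. The levels let such a sequence also escape to infinity, as (P3)
    requires. *)
Lemma finite_net_of_sequences (T : Type) (A : nat -> T -> Prop)
    (E : T -> T -> Prop) :
  (forall u : nat -> T, (forall n, A n (u n)) ->
     exists m n, (m < n)%N /\ E (u m) (u n)) ->
  exists (k n : nat) (c : 'I_n -> T), forall x, A k x -> exists i, E (c i) x.
Proof.
move=> Hseq; apply: contrapT => Hno.
have step (ks : nat * seq T) :
    exists x, A ks.1 x /\ forall i : 'I_(size ks.2), ~ E (tnth (in_tuple ks.2) i) x.
  apply: contrapT => Hx; apply: Hno; exists ks.1, (size ks.2), (tnth (in_tuple ks.2)).
  move=> x Ax; apply: contrapT => Hi; apply: Hx; exists x; split=> // i Ei.
  by apply: Hi; exists i.
have [next Hnext] := choice step.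
pose fix hist n := if n is m.+1 then rcons (hist m) (next (m, hist m)) else [::].
have size_hist n : size (hist n) = n by elim: n => //= n IH; rewrite size_rcons IH.
pose u n := next (n, hist n).
have nth_hist x0 m n : (m < n)%N -> nth x0 (hist n) m = u m.
  elim: n => //= n IH; rewrite ltnS leq_eqVlt nth_rcons size_hist.
  by case: (ltngtP m n) => [/IH||->].
have [|m [n [lt_mn Emn]]] := Hseq u; first by move=> n; case: (Hnext (n, hist n)).
have [_ /=] := Hnext (n, hist n).
have lt_m : (m < size (hist n))%N by rewrite size_hist.
by move/(_ (Ordinal lt_m)); rewrite (tnth_nth (u m)) /= nth_hist.
Qed.

Lemma infinite_pigeonhole (F : finType) (c : nat -> F) (A : nat -> Prop) :
  (forall n0, exists n, (n0 <= n)%N /\ A n) ->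
  exists v, forall n0, exists n, (n0 <= n)%N /\ (A n /\ c n = v).
Proof.
move=> infA; apply: contrapT => Hno.
have /choice[b Hb] : forall v, exists n0, forall n, (n0 <= n)%N -> A n -> c n <> v.
  move=> v; apply: contrapT => Hv; apply: Hno; exists v => n0.
  apply: contrapT => Hn; apply: Hv; exists n0 => n le_n An cn.
  by apply: Hn; exists n.
have [n [le_n An]] := infA (\max_(v : F) b v).
exact: Hb (leq_trans (leq_bigmax (c n)) le_n) An erefl.
Qed.

(** Nested infinite sets: [c k] is constant on [A k.+1], and [sigma n] is picked in [A n.+1], which
    is contained in all earlier ones. *)
Lemma diagonal_subsequence (F : nat -> finType) (c : forall k, nat -> F k) :
  exists sigma : nat -> nat, (forall n, (sigma n < sigma n.+1)%N) /\
    forall k m n, (k <= m)%N -> (k <= n)%N -> c k (sigma m) = c k (sigma n).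
Proof.
pose inf (A : nat -> Prop) := forall n0, exists n, (n0 <= n)%N /\ A n.
have step (kA : nat * (nat -> Prop)) : exists B : nat -> Prop, inf kA.2 ->
    inf B /\ forall n, B n -> kA.2 n /\ forall m, B m -> c kA.1 m = c kA.1 n.
  have [infA|] := pselect (inf kA.2); last by exists xpredT.
  have [v Hv] := infinite_pigeonhole _ (c kA.1) _ infA.
  exists (fun n => kA.2 n /\ c kA.1 n = v) => _; split=> // n [An cn].
  by split=> // m [_ ->].
have [next Hnext] := choice step.
pose fix A k := if k is j.+1 then next (j, A j) else fun=> True.
have infA k : inf (A k).
  elim: k => [n0|k IH]; first by exists n0.
  by have [] := Hnext (k, A k) IH.
have subA k j n : A (k + j)%N n -> A k n.
  elim: j => [|j IH]; first by rewrite addn0.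
  rewrite addnS => /= An; apply: IH.
  by have [_ /(_ n An)[]] := Hnext ((k + j)%N, A (k + j)%N) (infA _).
have /choice[pick Hpick] : forall kn : nat * nat, exists n, (kn.2 < n)%N /\ A kn.1.+1 n.
  by move=> [k n]; apply: infA.
pose fix sigma k := if k is j.+1 then pick (j.+1, sigma j) else pick (0%N, 0%N).
have sigmaA k n : (k <= n)%N -> A k.+1 (sigma n).
  move=> /subnKC <-; apply: (subA _ (n - k)%N); rewrite addSn.
  by case: (k + _)%N => [|j]; apply: (Hpick (_, _)).2.
exists sigma; split=> [n|k m n km kn]; first exact: (Hpick (n.+1, sigma n)).1.
have [_ /(_ _ (sigmaA _ _ kn))[_]] := Hnext (k, A k) (infA k).
by apply; apply: sigmaA.
Qed.

(** * Completeness and total boundedness for real and complex scalars *)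

Section RealLine.
Variable R : realType.

Lemma inv_nat_lt (e : R) : 0 < e -> exists k : nat, k.+1%:R^-1 < e.
Proof.
move=> e0; exists (Num.truncn e^-1).
rewrite -[ltRHS]invrK ltf_pV2 ?posrE ?invr_gt0 //.
by case/andP: (truncn_itv (ltW (etrans (invr_gt0 e) e0))).
Qed.

Lemma real_complete : complete_metric (fun a b : R => `|a - b|).
Proof.
move=> u Cu.
(* [E] collects the eventual lower bounds of [u], so [sup E] is its lower limit. *)
pose E : set R := fun x => exists N, forall n, (N <= n)%N -> x <= u n.
have [N1 H1] := Cu 1 ltr01.
have Elow N e : (forall m n, (N <= m)%N -> (N <= n)%N -> `|u m - u n| < e) -> E (u N - e).
  move=> H; exists N => n le_n; have := H N n (leqnn _) le_n.
  by rewrite ltr_norml => /andP[]; lra.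
have Eub N e : (forall m n, (N <= m)%N -> (N <= n)%N -> `|u m - u n| < e) ->
    ubound E (u N + e).
  move=> H x [N' HN']; have := H N (maxn N N') (leqnn _) (leq_maxl _ _).
  have := HN' _ (leq_maxr N N').
  by rewrite ltr_norml => ? /andP[]; lra.
have E0 : (E !=set0)%classic by exists (u N1 - 1); apply: Elow.
exists (sup E) => e e0.
have [N HN] := Cu (e / 3) ltac:(lra); exists N => n le_n.
have hn := HN N n (leqnn _) le_n.
have h1 : u N - e / 3 <= sup E.
  by apply: ub_le_sup; [exists (u N + e / 3); apply: Eub | apply: Elow].
have h2 : sup E <= u N + e / 3 by apply: ge_sup => //; apply: Eub.
move: hn; rewrite !ltr_norml => /andP[? ?]; apply/andP; split; lra.
Qed.

Lemma totally_bounded_fin (T : Type) (d : T -> T -> R) (S : T -> Prop) :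
  (forall e, 0 < e -> exists (F : finType) (c : F -> T),
     forall x, S x -> exists i, d x (c i) < e) ->
  totally_bounded d S.
Proof.
move=> H e e0; have [F [c Hc]] := H e e0.
exists #|F|, (c \o enum_val) => x /Hc[i Hi].
by exists (enum_rank i); rewrite /= enum_rankK.
Qed.

Lemma real_ball_totally_bounded (B : R) :
  totally_bounded (fun a b : R => `|a - b|) (fun a => `|a| <= B).
Proof.
(* A grid of mesh [e] starting at [- B]; the index of [x] is the integer part of [(x + B) / e]. *)
move=> e e0; pose n := (Num.truncn ((B + B) / e)).+1.
exists n, (fun i : 'I_n => - B + i%:R * e) => x; rewrite ler_norml => /andP[h1 h2].
have x0 : 0 <= (x + B) / e by rewrite divr_ge0 ?(ltW e0) //; lra.
have /andP[t1 t2] := truncn_itv x0.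
have lt_n : (Num.truncn ((x + B) / e) < n)%N.
  by rewrite ltnS; apply: le_truncn; rewrite ler_pM2r ?invr_gt0 //; lra.
exists (Ordinal lt_n) => /=; set t := (Num.truncn _)%:R in t1 *.
have t1e : t * e <= x + B by rewrite -ler_pdivlMr.
have t2e : x + B < (t + 1) * e by rewrite -ltr_pdivrMr // natr1.
rewrite ltr_norml; apply/andP; split; lra.
Qed.

(** The modulus with values in [R]: the norm of [R[i]] lands in [R[i]] itself. *)
Definition nrmC (z : R[i]) : R := Num.sqrt (complex.Re z ^+ 2 + complex.Im z ^+ 2).

Lemma nrmC_ge_Re z : `|complex.Re z| <= nrmC z.
Proof. by rewrite -sqrtr_sqr ler_sqrt ?addr_ge0 ?sqr_ge0 // lerDl sqr_ge0. Qed.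

Lemma nrmC_ge_Im z : `|complex.Im z| <= nrmC z.
Proof. by rewrite -sqrtr_sqr ler_sqrt ?addr_ge0 ?sqr_ge0 // lerDr sqr_ge0. Qed.

Lemma nrmC_le z : nrmC z <= `|complex.Re z| + `|complex.Im z|.
Proof.
rewrite -[leRHS]ger0_norm ?addr_ge0 // -sqrtr_sqr ler_sqrt ?sqr_ge0 //.
rewrite sqrrD !real_normK ?num_real //.
have := mulr_ge0 (normr_ge0 (complex.Re z)) (normr_ge0 (complex.Im z)); rewrite mulr2n; lra.
Qed.

Lemma ReB (a b : R[i]) : complex.Re (a - b) = complex.Re a - complex.Re b.
Proof. by case: a b => [? ?] [? ?]. Qed.

Lemma ImB (a b : R[i]) : complex.Im (a - b) = complex.Im a - complex.Im b.
Proof. by case: a b => [? ?] [? ?]. Qed.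

Lemma complex_complete : complete_metric (fun a b : R[i] => nrmC (a - b)).
Proof.
move=> u Cu.
have CP (p : R[i] -> R) : (forall a b, `|p a - p b| <= nrmC (a - b)) ->
    exists l, converges_to (fun a b : R => `|a - b|) (p \o u) l.
  move=> Hp; apply: real_complete => e e0; have [N HN] := Cu e e0.
  by exists N => m n ? ?; apply: le_lt_trans (Hp _ _) (HN _ _ _ _).
have [|s Hs] := CP (@complex.Re R); first by move=> a b; rewrite -ReB nrmC_ge_Re.
have [|t Ht] := CP (@complex.Im R); first by move=> a b; rewrite -ImB nrmC_ge_Im.
exists (s +i* t)%C => e e0.
have [N1 H1] := Hs (e / 2) ltac:(lra); have [N2 H2] := Ht (e / 2) ltac:(lra).
exists (maxn N1 N2) => n; rewrite geq_max => /andP[/H1 /= hs /H2 /= ht].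
by apply: le_lt_trans (nrmC_le _) _; rewrite ReB ImB /=; lra.
Qed.

Lemma complex_ball_totally_bounded (B : R) :
  totally_bounded (fun a b : R[i] => nrmC (a - b)) (fun a => nrmC a <= B).
Proof.
apply: totally_bounded_fin => e e0.
have [n [c Hc]] := real_ball_totally_bounded B (e / 2) ltac:(lra).
exists ('I_n * 'I_n)%type, (fun i => (c i.1 +i* c i.2)%C) => z le_z.
have [i Hi] := Hc _ (le_trans (nrmC_ge_Re z) le_z).
have [j Hj] := Hc _ (le_trans (nrmC_ge_Im z) le_z).
exists (i, j) => /=; apply: le_lt_trans (nrmC_le _) _; rewrite ReB ImB /=.
by move: Hi Hj => /=; lra.
Qed.

(** The colour of a point of [S] is a centre within [e / 2]. Finite colourings, unlike nets, combine
    directly with finite products and with [diagonal_subsequence]. *)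
Lemma totally_bounded_colouring (T : Type) (d : T -> T -> R) (S : T -> Prop) (e : R) :
  is_metric d -> totally_bounded d S -> 0 < e ->
  exists (F : finType) (col : T -> F),
    forall x y, S x -> S y -> col x = col y -> d x y <= e.
Proof.
move=> [_ _ dC dT] tbS e0; have [n [c Hc]] := tbS (e / 2) ltac:(lra).
have /choice[col Hcol] : forall x, exists o : option 'I_n,
    S x -> exists2 i, o = Some i & d x (c i) < e / 2.
  move=> x; have [/Hc[i Hi]|] := pselect (S x); last by exists None.
  by exists (Some i) => _; exists i.
exists (option 'I_n), col => x y /Hcol[i -> xi] /Hcol[j -> yj] [eq_ij].
have := dT x (c i) y; rewrite [d (c i) y]dC; subst j; lra.
Qed.

End RealLine.

(** * Necessity: (P1), (P2) and (P3) from a finite net of molecules *)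

Section MoleculeNet.
Variables (R : realType) (M N : Type) (dM : M -> M -> R) (dN : N -> N -> R).
Variables (oM : M) (oN : N) (f : M -> N).
Hypotheses (metM : is_metric dM) (metN : is_metric dN).
Hypothesis (f0 : f oM = oN).

Definition tent (r : R) (q w : N) : R := Num.max 0 (r - dN w q).

Lemma metric_gt0 (T : Type) (d : T -> T -> R) x y :
  is_metric d -> x <> y -> 0 < d x y.
Proof.
move=> [d0 dE _ _] ne; rewrite lt_neqAle d0 andbT eq_sym.
by apply/eqP => /dE.
Qed.

Lemma tent_lip r q z w : `|tent r q z - tent r q w| <= dN z w.
Proof.
case: metN => d0 _ dC dT.
have := dT z w q; have := dT w z q; have := d0 z w; rewrite (dC w z) /tent.
rewrite ler_norml => ? ? ?.
by case: (leP 0 (r - dN z q)) => ?; case: (leP 0 (r - dN w q)) => ?;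
  apply/andP; split; lra.
Qed.

Lemma tent_center r q : 0 <= r -> tent r q q = r.
Proof.
case: metN => _ dE _ _ r0; rewrite /tent (dE q q).2 // subr0.
exact: max_r.
Qed.

Lemma tent_far r q w : r <= dN q w -> tent r q w = 0.
Proof.
by case: metN => _ _ dC _ le_r; rewrite /tent max_l // subr_le0 dC.
Qed.

Lemma tent_dist_le r q z w : 0 <= r -> `|tent r q z - tent r q w| <= r.
Proof.
case: metN => d0 _ _ _ r0; have := d0 z q; have := d0 w q; rewrite /tent.
rewrite ler_norml => ? ?.
by case: (leP 0 (r - dN z q)) => ?; case: (leP 0 (r - dN w q)) => ?;
  apply/andP; split; lra.
Qed.

(* The operator image of the set of molecules is totally bounded, tested only
   against real-valued 1-Lipschitz functions. *)
Definition molecule_net : Prop := forall e : R, 0 < e ->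
  exists (n : nat) (a b : 'I_n -> M), forall x y, x <> y -> exists i : 'I_n,
    forall g : N -> R, (forall z w, `|g z - g w| <= dN z w) ->
      `|(g (f x) - g (f y)) / dM x y
        - (g (f (a i)) - g (f (b i))) / dM (a i) (b i)| <= e.

Hypothesis net : molecule_net.

(** The tent at [f y] of height [r = dN (f x) (f y)] has quotient [- r / dM x y] on [(x, y)] and at
    most [r * A] in modulus on the net, whence [r / dM x y <= e / 2 + r * A]; the Lipschitz bound
    makes [r * A] small at short distances. *)
Lemma molecule_net_P2 : lipschitz dM dN f -> P2 dM dN f.
Proof.
move=> [L [L0 fL]] e e0; have [n [a [b Hab]]] := net (e / 2) ltac:(lra).
pose A := \sum_(i < n) (dM (a i) (b i))^-1.
have dV0 (i : 'I_n) : 0 <= (dM (a i) (b i))^-1.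
  by case: metM => d0 _ _ _; rewrite invr_ge0.
have A0 : 0 <= A by apply: sumr_ge0.
have AL0 : 0 <= A * L by exact: mulr_ge0.
have AL1 : 0 < A * L + 1 by rewrite ltr_wpDl.
(* Below this distance [A * L * dM x y <= e / 2]; the added [1] keeps the denominator positive. *)
exists (e / 2 / (A * L + 1)); first by rewrite !divr_gt0.
move=> x y D0 Dle; have dN0 : 0 <= dN (f x) (f y) by case: metN.
have ne : x <> y by case: metM => _ dE _ _ /dE E; rewrite E ltxx in D0.
have [i /(_ (tent (dN (f x) (f y)) (f y)) (tent_lip _ _))] := Hab x y ne.
rewrite tent_center // tent_far; last by case: metN => _ _ -> _.
rewrite sub0r; set t := (_ - _) / _; set r := dN _ _ in dN0 * => Ht.
have le_t : `|t| <= r * A.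
  rewrite normrM (ger0_norm (dV0 i)); apply: ler_pM => //.
    exact: tent_dist_le.
  by rewrite /A (bigD1 i) //= lerDl sumr_ge0.
have le_r : r / dM x y <= e / 2 + r * A.
  move: Ht le_t; rewrite mulNr !ler_norml => /andP[? ?] /andP[? ?]; lra.
have le_A : r * A <= e / 2.
  apply: (@le_trans _ _ (L * dM x y * A)); first by rewrite ler_wpM2r ?fL.
  move: Dle; rewrite ler_pdivlMr // mulrDr mulr1.
  have := ltW D0; set D := dM x y => ? ?.
  have -> : L * D * A = D * (A * L) by ring.
  lra.
rewrite -ler_pdivrMr //; lra.
Qed.

(** The tent of radius [r] at [f y] vanishes at [f x] and at every centre, so the comparison with
    the net reduces to [r / dM x y <= e]. The centre [oN] serves [molecule_net_P1]. *)
Lemma molecule_net_centers e : 0 < e ->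
  exists (F : finType) (c : F -> N), (exists i, c i = oN) /\
    forall x y r, x <> y -> 0 < r -> r <= dN (f x) (f y) ->
      (forall i, r <= dN (f y) (c i)) -> r <= e * dM x y.
Proof.
move=> e0; have [n [a [b Hab]]] := net e e0.
pose c (i : option ('I_n + 'I_n)) := match i with
  | Some (inl i) => f (a i) | Some (inr i) => f (b i) | None => oN end.
exists (option ('I_n + 'I_n))%type, c; split; first by exists None.
move=> x y r ne r0 le_r far; have D0 := metric_gt0 _ _ _ _ metM ne.
have [i /(_ (tent r (f y)) (tent_lip _ _))] := Hab x y ne.
rewrite (tent_center _ _ (ltW r0)).
rewrite (tent_far _ _ (f x)); last by case: metN => _ _ -> _.
rewrite (tent_far _ _ _ (far (Some (inl i)))) (tent_far _ _ _ (far (Some (inr i)))).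
rewrite sub0r subrr mul0r subr0 mulNr normrN ger0_norm; last by rewrite divr_ge0 ?ltW.
by rewrite ler_pdivrMr.
Qed.

(** Apply the centres to the pair [(oM, x)]: a point [f x] at distance at least [e] from all of
    them, [oN] included, would give [e <= e / (|B| + 1) * dM oM x < e]. *)
Lemma molecule_net_P1 : P1 dM dN oM f.
Proof.
move=> S [B HB]; apply: totally_bounded_fin => e e0.
have B1 : 0 < `|B| + 1 by rewrite ltr_wpDl.
have [|F [c [[i0 ci0] Hc]]] := molecule_net_centers (e / (`|B| + 1)).
  by rewrite divr_gt0.
exists F, c => _ [x Sx ->]; apply: contrapT => Hx.
have far i : e <= dN (f x) (c i).
  by rewrite leNgt; apply/negP => lt_e; apply: Hx; exists i.
have [_ dNE dNC _] := metN.
have ne : oM <> x.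
  by move=> E; have := far i0; rewrite ci0 -E f0 (dNE oN oN).2 // leNgt e0.
have := Hc oM x e ne e0; rewrite f0 dNC -ci0 => /(_ (far i0) far).
rewrite mulrAC ler_pdivlMr // leNgt => /negP; apply; rewrite ltr_pM2l //.
by apply: (le_lt_trans (HB x Sx)); have := ler_norm B; lra.
Qed.

(* The centres force [d (f x) (f y)] to be bounded along the pairs with ratio
   at least [c], and then to lie in a totally bounded set. *)
Lemma molecule_net_P3 : complete_metric dN -> P3 dM dN oM f.
Proof.
move=> complN x y ne _ _; have [dN0 dNE dNC dNT] := metN.
have [dM0 dME dMC dMT] := metM.
have [|] := pselect (forall e : R, 0 < e -> forall n0, exists2 n, (n0 <= n)%N &
  dN (f (x n)) (f (y n)) / dM (x n) (y n) < e); first by right.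
move=> Hneg; left; move: Hneg.
move=> /existsNP[c /not_implyP[c0 /existsNP[n0 Hn0]]].
have ratio n : (n0 <= n)%N -> c * dM (x n) (y n) <= dN (f (x n)) (f (y n)).
  move=> le_n; rewrite -ler_pdivlMr ?(metric_gt0 _ _ _ _ metM) // leNgt.
  by apply/negP => lt_c; apply: Hn0; exists n.
(* Centres for tolerance [e * c]: if [f y] were at distance at least [r] from them all, then [r <= e
   * c * dM x y <= e * dN (f x) (f y) < r]. Swapping the pair handles [f x]. *)
have near e : 0 < e -> exists (F : finType) (z : F -> N),
    forall x y r, x <> y -> 0 < r -> c * dM x y <= dN (f x) (f y) ->
      r <= dN (f x) (f y) -> e * dN (f x) (f y) < r ->
      exists i j, dN (f x) (z i) < r /\ dN (f y) (z j) < r.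
  move=> e0; have [|F [z [_ Hz]]] := molecule_net_centers (e * c).
    exact: mulr_gt0.
  have near1 u v r : u <> v -> 0 < r -> c * dM u v <= dN (f u) (f v) ->
      r <= dN (f u) (f v) -> e * dN (f u) (f v) < r -> exists i, dN (f v) (z i) < r.
    move=> uv r0 rat le_r lt_r; apply: contrapT => Hi.
    have /(Hz u v r uv r0 le_r) : forall i, r <= dN (f v) (z i).
      by move=> i; rewrite leNgt; apply/negP => ?; apply: Hi; exists i.
    rewrite leNgt => /negP; apply; apply: le_lt_trans lt_r.
    by rewrite -mulrA ler_pM2l.
  exists F, z => u v r uv r0 rat le_r lt_r.
  have [j Hj] := near1 u v r uv r0 rat le_r lt_r.
  have := near1 v u r (nesym uv) r0; rewrite [dN (f v) (f u)]dNC [dM v u]dMC.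
  move=> /(_ rat le_r lt_r)[i Hi].
  by exists i, j.
have fxy0 n : (n0 <= n)%N -> 0 < dN (f (x n)) (f (y n)).
  move=> le_n; apply: lt_le_trans (ratio n le_n).
  by rewrite mulr_gt0 // (metric_gt0 _ _ _ _ metM).
have [B B0 HB] : exists2 B, 0 < B & forall n, (n0 <= n)%N -> dN (f (x n)) (f (y n)) <= B.
  (* The radius is a quarter of the distance [D] between the images:
     [D <= D / 4 + dN (z i) (z j) + D / 4], so [D] is at most twice a distance between centres. *)
  have [|F [z Hz]] := near (8^-1); first by lra.
  exists (1 + 2 * \sum_i \sum_j dN (z i) (z j)).
    by rewrite ltr_wpDr // mulr_ge0 // sumr_ge0 // => i _; rewrite sumr_ge0.
  move=> n le_n; have d0 := fxy0 n le_n.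
  have [|||i [j [Hi Hj]]] := Hz (x n) (y n) (dN (f (x n)) (f (y n)) / 4) (ne n) _ (ratio n le_n).
  - lra.
  - lra.
  - lra.
  have le_s : dN (z i) (z j) <= \sum_i \sum_j dN (z i) (z j).
    rewrite (bigD1 i) //= (bigD1 j) //= -addrA lerDl addr_ge0 ?sumr_ge0 // => k _.
    by rewrite sumr_ge0.
  have := dNT (f (x n)) (z i) (f (y n)); have := dNT (z i) (z j) (f (y n)).
  rewrite [dN (z j) _]dNC; lra.
have col k : exists (F : finType) (cl : nat -> F), forall m n, (n0 <= m)%N -> (n0 <= n)%N ->
    cl m = cl n -> dN (f (x m)) (f (x n)) < k.+1%:R^-1 /\ dN (f (y m)) (f (y n)) < k.+1%:R^-1.
  set e := k.+1%:R^-1; have e0 : 0 < e :> R by rewrite invr_gt0.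
  (* This [h] makes [h * dN (f (x n)) (f (y n))] smaller than both terms of the minimum taken as
     radius below, as [near] demands. *)
  pose h := Num.min (2^-1) (e / 4 / B).
  have h0 : 0 < h by rewrite lt_min; apply/andP; split; rewrite ?divr_gt0 //; lra.
  have [F [z Hz]] := near h h0.
  have /choice[cl Hcl] : forall n, exists o : option (F * F), (n0 <= n)%N ->
      exists ij, o = Some ij /\ (dN (f (x n)) (z ij.1) < e / 2 /\ dN (f (y n)) (z ij.2) < e / 2).
    move=> n; have [le_n|] := boolP (n0 <= n)%N; last by exists None.
    have d0 := fxy0 n le_n; have dB := HB n le_n.
    have hd1 : h * dN (f (x n)) (f (y n)) < dN (f (x n)) (f (y n)).
      by rewrite -[ltRHS]mul1r ltr_pM2r // gt_min; apply/orP; left; lra.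
    have hd2 : h * dN (f (x n)) (f (y n)) < e / 2.
      apply: (@le_lt_trans _ _ (e / 4)); last by lra.
      apply: (@le_trans _ _ (h * B)); first by rewrite ler_pM2l.
      by rewrite -ler_pdivlMr // ge_min lexx orbT.
    have [|||i [j [Hi Hj]]] :=
      Hz (x n) (y n) (Num.min (dN (f (x n)) (f (y n))) (e / 2)) (ne n) _ (ratio n le_n).
    - by rewrite lt_min d0; lra.
    - by rewrite ge_min lexx.
    - by rewrite lt_min hd1.
    exists (Some (i, j)) => _; exists (i, j); split=> //.
    by move: Hi Hj; rewrite !lt_min => /andP[_ ->] /andP[_ ->].
  exists (option (F * F))%type, cl => m n le_m le_n.
  have [ij [-> [h1 h2]]] := Hcl m le_m; have [kl [-> [h3 h4]]] := Hcl n le_n.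
  move=> [E]; rewrite -E in h3 h4.
  have := dNT (f (x m)) (z ij.1) (f (x n)); have := dNT (f (y m)) (z ij.2) (f (y n)).
  rewrite [dN (z ij.1) _]dNC [dN (z ij.2) _]dNC; lra.
(* Extraction starts at [n0], where the ratio bound begins; along [sigma] both coordinates of the
   images are then Cauchy. *)
have [sigma [sigma_lt Hsigma]] := diagonal_subsequence _
  (fun k n => projT1 (cid (projT2 (cid (col k)))) (n0 + n)%N).
have {Hsigma} close k m n : (k <= m)%N -> (k <= n)%N ->
    dN (f (x (n0 + sigma m)%N)) (f (x (n0 + sigma n)%N)) < k.+1%:R^-1 /\
    dN (f (y (n0 + sigma m)%N)) (f (y (n0 + sigma n)%N)) < k.+1%:R^-1.
  move=> km kn; apply: (projT2 (cid (projT2 (cid (col k))))); rewrite ?leq_addr //.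
  exact: Hsigma.
have [|p Hp] := complN (fun n => f (x (n0 + sigma n)%N)).
  move=> e /inv_nat_lt[k Hk]; exists k => m n km kn.
  by apply: lt_trans Hk; case: (close k m n km kn).
have [|q Hq] := complN (fun n => f (y (n0 + sigma n)%N)).
  move=> e /inv_nat_lt[k Hk]; exists k => m n km kn.
  by apply: lt_trans Hk; case: (close k m n km kn).
exists p, q => e e0 n1; have [N1 H1] := Hp e e0; have [N2 H2] := Hq e e0.
pose m := maxn n1 (maxn N1 N2); exists (n0 + sigma m)%N.
  apply: leq_trans (leq_addl _ _); apply: leq_trans (increasing_ge_id _ sigma_lt _).
  exact: leq_maxl.
by split; [apply: H1 | apply: H2]; rewrite !leq_max leqnn ?orbT.
Qed.

End MoleculeNet.

(** * Sufficiency, first half: covering the images of steep pairs *)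

Lemma tends_to_infty_ge_nat (R : realType) (M : Type) (d : M -> M -> R) (o : M)
    (u : nat -> M) :
  (forall n, n%:R <= d (u n) o) -> tends_to_infty d o u.
Proof.
move=> Hu A; exists (Num.truncn `|A|).+1 => n le_n.
apply: lt_le_trans (Hu n); apply: le_lt_trans (ler_norm A) _.
have /andP[_ lt_A] := truncn_itv (normr_ge0 A).
by apply: lt_le_trans lt_A _; rewrite ler_nat.
Qed.

Section SteepPairs.
Variables (R : realType) (M N : Type) (dM : M -> M -> R) (dN : N -> N -> R).
Variables (oM : M) (oN : N) (f : M -> N).
Hypotheses (metM : is_metric dM) (metN : is_metric dN).
Hypotheses (lipf : lipschitz dM dN f) (f0 : f oM = oN).
Hypothesis (p3 : P3 dM dN oM f).

(* Otherwise pair each steep point with a much farther steep one: the ratios of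
   these pairs stay bounded below while the images escape to infinity. *)
Lemma P3_sublinear (e : R) : 0 < e ->
  exists r, forall x, r <= dM x oM -> dN (f x) oN <= e * dM x oM.
Proof.
move=> e0; apply: contrapT => Hno; have [L [L0 fL]] := lipf.
have [dM0 dME dMC dMT] := metM; have [dN0 dNE dNC dNT] := metN.
have /choice[X HX] : forall r, exists x, r <= dM x oM /\ e * dM x oM < dN (f x) oN.
  move=> r; apply: contrapT => Hr; apply: Hno; exists r => x le_r.
  by rewrite leNgt; apply/negP => lt_e; apply: Hr; exists x.
pose x n := X n%:R; pose t n := dM (x n) oM.
(* This threshold forces [t n < s n] and [2 * L * t n <= e * s n]; hence the images are at least
   [e * s n / 2] apart, while [dM (x n) (y n) <= 2 * s n]. *)
pose y n := X (n%:R + t n + 1 + 2 * L * t n / e); pose s n := dM (y n) oM.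
have t0 n : 0 <= t n by exact: dM0.
have xt n : n%:R <= t n by case: (HX n%:R).
have Lt0 n : 0 <= 2 * L * t n / e by rewrite divr_ge0 ?mulr_ge0 // ltW.
have [ys yf] : (forall n, n%:R + t n + 1 + 2 * L * t n / e <= s n) /\
    (forall n, e * s n < dN (f (y n)) oN).
  by split=> n; case: (HX (n%:R + t n + 1 + 2 * L * t n / e)).
have n_ge0 n : 0 <= n%:R :> R by [].
have st n : t n < s n by have := ys n; have := Lt0 n; have := n_ge0 n; lra.
have xy n : x n <> y n by move=> E; have := st n; rewrite /t /s E ltxx.
have Lts n : 2 * L * t n <= e * s n.
  rewrite [e * _]mulrC -ler_pdivrMr //; have := ys n; have := n_ge0 n.
  by have := t0 n; lra.
have ratio n : e / 4 <= dN (f (x n)) (f (y n)) / dM (x n) (y n).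
  rewrite ler_pdivlMr ?(metric_gt0 _ _ _ _ _ metM) //.
  have := dMT (x n) oM (y n); rewrite [dM oM _]dMC -/(t n) -/(s n) => le_d.
  have := dNT (f (y n)) (f (x n)) oN; rewrite [dN (f (y n)) (f _)]dNC => le_dN.
  have fx : dN (f (x n)) oN <= L * t n by rewrite -f0; apply: fL.
  have h1 : e / 4 * dM (x n) (y n) <= e / 4 * (2 * s n).
    by rewrite ler_pM2l; have := st n; lra.
  by have := yf n; have := Lts n; lra.
have [||[p [q Hpq]]|H] := p3 x y xy.
- exact: tends_to_infty_ge_nat.
- by apply: tends_to_infty_ge_nat => n; have := ys n; have := Lt0 n; have := t0 n; rewrite -/(s n); lra.
(* Past [n0], [dN (f (y n)) oN] exceeds [dN q oN + 1], so [f (y n)] cannot be within [1] of [q]. *)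
- have B0 : 0 <= (dN q oN + 1) / e by rewrite divr_ge0 ?addr_ge0 // ltW.
  have /andP[_] := truncn_itv B0; set n0 := (_.+1) => lt_n0.
  have [n le_n [_ lt_q]] := Hpq 1 ltr01 n0.
  have le_s : n0%:R <= s n.
    apply: (@le_trans _ _ n%:R); first by rewrite ler_nat.
    by have := ys n; have := Lt0 n; have := t0 n; lra.
  have : (dN q oN + 1) / e < s n by exact: lt_le_trans le_s.
  rewrite ltr_pdivrMr // => ?; have := yf n; have := dNT (f (y n)) q oN; lra.
- have [|n _] := H (e / 4) _ 0%N; first by lra.
  by move=> lt_n; have := ratio n; rewrite leNgt lt_n.
Qed.

Hypothesis (p1 : P1 dM dN oM f).

(** By [finite_net_of_sequences] only sequences of steep pairs escaping to infinity need testing. In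
    (P3), steepness rules out a zero lower limit, and two terms near an accumulation point have
    close images. *)
Lemma far_steep_pairs_net (eta e : R) : 0 < eta -> 0 < e ->
  exists (k n : nat) (c : 'I_n -> N), forall x y, k%:R < dM x oM -> k%:R < dM y oM ->
    eta * dM x y < dN (f x) (f y) -> exists i, dN (f x) (c i) < e.
Proof.
move=> eta0 e0; have [dM0 dME dMC dMT] := metM; have [dN0 dNE dNC dNT] := metN.
pose A k (p : M * M) := [/\ k%:R < dM p.1 oM, k%:R < dM p.2 oM &
  eta * dM p.1 p.2 < dN (f p.1) (f p.2)].
pose E (p q : M * M) := dN (f q.1) (f p.1) < e.
have [u Au|k [n [c Hc]]] := @finite_net_of_sequences _ A E; last first.
  exists k, n, (fun i => f (c i).1) => x y xk yk steep.
  by have [|i Hi] := Hc (x, y); [split | exists i].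
have ne n : (u n).1 <> (u n).2.
  move=> eq12; have [_ _] := Au n; rewrite eq12 (dME _ _).2 // (dNE _ _).2 //.
  by rewrite mulr0 ltxx.
have [||[p [q Hpq]]|H] := p3 (fst \o u) (snd \o u) ne.
- by apply: tends_to_infty_ge_nat => n; case: (Au n) => /ltW.
- by apply: tends_to_infty_ge_nat => n; case: (Au n) => _ /ltW.
- have [|m _ [Hm _]] := Hpq (e / 2) _ 0%N; first by lra.
  have [|n lt_mn [Hn _]] := Hpq (e / 2) _ m.+1; first by lra.
  exists m, n; split=> //; have := dNT (f (u n).1) p (f (u m).1).
  rewrite /E [dN p _]dNC; move: Hm Hn => /=; lra.
- have [n _ /=] := H eta eta0 0%N; rewrite ltr_pdivrMr ?(metric_gt0 _ _ _ _ _ metM) //.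
  by have [_ _] := Au n; rewrite ltNge => /negP h /ltW.
Qed.

(** For [x] in a large ball (P1) gives centres; when both ends lie beyond [k], [far_steep_pairs_net]
    does. In the remaining case [x] is very far and [y] within [k], and sublinear growth makes the
    pair flat. Covering first images suffices, as steepness is symmetric. *)
Lemma steep_pairs_net (eta e : R) : 0 < eta -> 0 < e ->
  exists (F : finType) (c : F -> N), forall x y,
    eta * dM x y < dN (f x) (f y) -> exists i, dN (f x) (c i) < e.
Proof.
move=> eta0 e0; have [L [L0 fL]] := lipf.
have [dM0 dME dMC dMT] := metM; have [dN0 dNE dNC dNT] := metN.
have [k [n [c Hc]]] := far_steep_pairs_net eta e eta0 e0.
have [r0 Hr0] := P3_sublinear (eta / 4) ltac:(lra).
have k0 : 0 <= k%:R :> R by [].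
have Lk0 : 0 <= L * k%:R by exact: mulr_ge0.
(* Beyond radius [K], [(L + eta) * k] is at most a quarter of [eta * dM y oM]; [dN (f y) oN] costs
   another quarter, so the sum stays below [eta * dM y oM]. *)
pose K : R := 4 * (L + eta) * k%:R / eta.
have K0 : 0 <= K by rewrite /K divr_ge0 ?mulr_ge0 ?addr_ge0 // ltW.
pose r := `|r0| + K.
have flat x y : dM x oM <= k%:R -> r < dM y oM -> dN (f x) (f y) <= eta * dM x y.
  move=> xk yr; have le_r0 : r0 <= dM y oM.
    by have := ler_norm r0; rewrite /r in yr; lra.
  have fy := Hr0 y le_r0.
  have fx : dN (f x) oN <= L * k%:R.
    by rewrite -f0; apply: le_trans (fL _ _) _; rewrite ler_wpM2l.
  have : K <= dM y oM by have := normr_ge0 r0; rewrite /r in yr; lra.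
  rewrite /K ler_pdivrMr // => le_K.
  have := dNT (f x) oN (f y); rewrite [dN oN _]dNC => dle.
  have Dle : dM y oM - k%:R <= dM x y by have := dMT y x oM; rewrite [dM y x]dMC; lra.
  have : eta * (dM y oM - k%:R) <= eta * dM x y by rewrite ler_pM2l.
  have := dM0 y oM; have : 0 <= eta * dM y oM by rewrite mulr_ge0 // ltW.
  have : 4 * (L + eta) * k%:R = 4 * (L * k%:R) + 4 * (eta * k%:R) by ring.
  rewrite mulrBr [dM y oM * _]mulrC in le_K *; lra.
have [|m [b Hb]] := p1 (fun x => dM oM x <= Num.max k%:R r) _ e e0.
  by exists (Num.max k%:R r).
exists ('I_n + 'I_m)%type, (fun i => match i with inl i => c i | inr i => b i end).
move=> x y steep.
have [le_x|lt_x] := leP (dM oM x) (Num.max k%:R r).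
  have [|i Hi] := Hb (f x); first by exists x.
  by exists (inr i).
move: lt_x; rewrite gt_max => /andP[kx rx]; rewrite dMC in kx; rewrite dMC in rx.
have [le_y|lt_y] := leP (dM y oM) k%:R.
  by have := flat y x le_y rx; rewrite dNC dMC leNgt steep.
by have [i Hi] := Hc x y kx lt_y steep; exists (inl i).
Qed.

End SteepPairs.

(** * Functionals on Lip_0 over a scalar field with real-valued norm [nrm] *)

Section Operator.
Variables (R : realType) (K : numFieldType) (emb : {rmorphism R -> K}).
Variable nrm : K -> R.
Hypothesis ler_emb : forall r s, (emb r <= emb s) = (r <= s).
Hypothesis normE : forall a, `|a| = emb (nrm a).
Hypothesis K_complete : complete_metric (fun a b : K => nrm (a - b)).
Hypothesis K_ball_tb : forall B : R,
  totally_bounded (fun a b : K => nrm (a - b)) (fun a => nrm a <= B).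

Lemma norm_le_emb a c : (`|a| <= emb c) = (nrm a <= c).
Proof. by rewrite normE ler_emb. Qed.

Lemma emb_inj : injective emb.
Proof. by move=> r s E; apply/eqP; rewrite eq_le -!ler_emb E lexx. Qed.

Lemma nrm_ge0 a : 0 <= nrm a.
Proof. by rewrite -ler_emb -normE rmorph0. Qed.

Lemma nrmD a b : nrm (a + b) <= nrm a + nrm b.
Proof. by rewrite -ler_emb rmorphD -!normE ler_normD. Qed.

Lemma nrmM a b : nrm (a * b) = nrm a * nrm b.
Proof. by apply: emb_inj; rewrite rmorphM -!normE normrM. Qed.

Lemma nrmN a : nrm (- a) = nrm a.
Proof. by apply: emb_inj; rewrite -!normE normrN. Qed.

Lemma nrmB a b : nrm (a - b) <= nrm a + nrm b.
Proof. by rewrite -(nrmN b) nrmD. Qed.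

Lemma nrm_distC a b : nrm (a - b) = nrm (b - a).
Proof. by rewrite -nrmN opprB. Qed.

Lemma nrm_dist_tri a b c : nrm (a - c) <= nrm (a - b) + nrm (b - c).
Proof. by rewrite -[a - c](subrKA b) nrmD. Qed.

Lemma nrm_emb r : nrm (emb r) = `|r|.
Proof.
apply: emb_inj; rewrite -normE; have [r0|r0] := leP 0 r.
  by rewrite (ger0_norm r0) ger0_norm // -(rmorph0 emb) ler_emb.
rewrite (ltr0_norm r0) rmorphN ler0_norm //.
by rewrite -(rmorph0 emb) ler_emb ltW.
Qed.

Lemma nrm0 : nrm 0 = 0.
Proof. by rewrite -(rmorph0 emb) nrm_emb normr0. Qed.

Lemma nrm_eq0 a : nrm a = 0 -> a = 0.
Proof. by move=> a0; apply/eqP; rewrite -normr_eq0 normE a0 rmorph0. Qed.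

Lemma nrm_metric : is_metric (fun a b : K => nrm (a - b)).
Proof.
split=> [a b|a b|a b|a b c].
- exact: nrm_ge0.
- by split=> [/nrm_eq0/eqP|->]; [rewrite subr_eq0 => /eqP | rewrite subrr nrm0].
- exact: nrm_distC.
- exact: nrm_dist_tri.
Qed.

Lemma Lip0_ballP (T : Type) (d : T -> T -> R) o g :
  Lip0_ball emb d o g <-> g o = 0 /\ forall x y, nrm (g x - g y) <= d x y.
Proof. by split=> -[g0 Hg]; split=> // x y; have := Hg x y; rewrite norm_le_emb. Qed.

Lemma dnorm_leP (T : Type) (d : T -> T -> R) o phi c :
  dnorm_le emb d o phi c <-> forall g, Lip0_ball emb d o g -> nrm (phi g) <= c.
Proof. by split=> H g /H; rewrite norm_le_emb. Qed.

Section Functionals.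
Variables (T : Type) (d : T -> T -> R) (o : T).
Hypothesis met : is_metric d.

(** Trading [L] for [|L| + 1] makes the constant positive, so that functions can be divided by
    it. *)
Lemma Lip0P g :
  Lip0 emb d o g <-> exists L, [/\ 0 < L, g o = 0 & forall x y, nrm (g x - g y) <= L * d x y].
Proof.
split=> [[g0 [L HL]]|[L [L0 g0 HL]]]; last first.
  by split=> //; exists L => x y; rewrite norm_le_emb.
exists (`|L| + 1); split=> // [|x y]; first by rewrite ltr_wpDl.
have := HL x y; rewrite norm_le_emb => /le_trans; apply.
by case: met => d0 _ _ _; rewrite ler_wpM2r //; have := ler_norm L; lra.
Qed.

Lemma Lip0_ball_Lip0 g : Lip0_ball emb d o g -> Lip0 emb d o g.
Proof. by case=> g0 Hg; split=> //; exists 1 => x y; rewrite mul1r. Qed.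

Lemma Lip0_lin a b g h : Lip0 emb d o g -> Lip0 emb d o h ->
  Lip0 emb d o (fun z => a * g z + b * h z).
Proof.
move=> [g0 [L HL]] [h0 [L' HL']]; split; first by rewrite g0 h0 !mulr0 addr0.
exists (nrm a * L + nrm b * L') => x y; rewrite norm_le_emb.
have -> : a * g x + b * h x - (a * g y + b * h y) = a * (g x - g y) + b * (h x - h y).
  by ring.
apply: le_trans (nrmD _ _) _; rewrite !nrmM mulrDl -!mulrA.
by apply: lerD; rewrite ler_wpM2l ?nrm_ge0 // -norm_le_emb.
Qed.

Definition linear_on_Lip0 (phi : (T -> K) -> K) : Prop :=
  forall (a b : K) (g h : T -> K), Lip0 emb d o g -> Lip0 emb d o h ->
     phi (fun z => a * g z + b * h z) = a * phi g + b * phi h.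

Lemma linear_dsub phi psi :
  linear_on_Lip0 phi -> linear_on_Lip0 psi -> linear_on_Lip0 (dsub phi psi).
Proof.
by move=> lphi lpsi a b g h Hg Hh; rewrite /dsub lphi // lpsi //; ring.
Qed.

Lemma linear_span m : in_span_delta emb d o m -> linear_on_Lip0 m.
Proof.
move=> [n [a [xs Hm]]] b c g h Hg Hh; rewrite !Hm //; last exact: Lip0_lin.
rewrite !mulr_sumr -big_split; apply: eq_bigr => i _ /=.
by rewrite /delta; ring.
Qed.

Lemma linearB phi g h : linear_on_Lip0 phi -> Lip0 emb d o g -> Lip0 emb d o h ->
  phi (fun z => g z - h z) = phi g - phi h.
Proof.
move=> lphi Hg Hh; have := lphi 1 (-1) g h Hg Hh; rewrite mul1r mulN1r => <-.
by congr phi; apply: funext => z; rewrite mul1r mulN1r.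
Qed.

(** Rescaling: [g] divided by [L] lies in the unit ball, and linearity pulls the factor out. *)
Lemma dual_bound phi c g L : linear_on_Lip0 phi -> dnorm_le emb d o phi c ->
  0 < L -> g o = 0 -> (forall x y, nrm (g x - g y) <= L * d x y) ->
  nrm (phi g) <= c * L.
Proof.
move=> lphi /dnorm_leP Hphi L0 g0 HL.
have eL : emb L != 0 by rewrite fmorph_eq0 gt_eqF.
pose h z := (emb L)^-1 * g z.
have Hh : Lip0_ball emb d o h.
  apply/Lip0_ballP; split=> [|x y]; first by rewrite /h g0 mulr0.
  rewrite /h -mulrBr nrmM -fmorphV nrm_emb gtr0_norm ?invr_gt0 //.
  by rewrite mulrC ler_pdivrMr // mulrC.
have -> : g = (fun z => emb L * h z + 0 * h z).
  by apply: funext => z; rewrite /h mul0r addr0 mulrA divff // mul1r.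
rewrite lphi; try exact: Lip0_ball_Lip0.
by rewrite mul0r addr0 nrmM nrm_emb gtr0_norm // mulrC ler_pM2r // Hphi.
Qed.

Definition molecule (x y : T) : (T -> K) -> K :=
  fun g => emb (d x y)^-1 * (g x - g y).

Lemma molecule_norm x y : dnorm_le emb d o (molecule x y) 1.
Proof.
apply/dnorm_leP => g /Lip0_ballP[_ Hg]; rewrite nrmM nrm_emb.
have d0 : 0 <= d x y by case: met.
rewrite ger0_norm ?invr_ge0 //; apply: (@le_trans _ _ ((d x y)^-1 * d x y)).
  by rewrite ler_wpM2l ?invr_ge0.
by have [->|ne] := eqVneq (d x y) 0; rewrite ?mulr0 // mulVf.
Qed.

Lemma molecule_in_free x y : in_free emb d o (molecule x y).
Proof.
split.
  split; last by exists 1; apply: molecule_norm.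
  by move=> a b g h _ _; rewrite /molecule; ring.
move=> e e0; exists (molecule x y); last first.
  by apply/dnorm_leP => g _; rewrite /dsub subrr nrm0 ltW.
exists 2%N, (fun i => if i == ord0 then emb (d x y)^-1 else - emb (d x y)^-1).
exists (fun i => if i == ord0 then x else y) => g _.
by rewrite !big_ord_recl big_ord0 /= /molecule /delta; ring.
Qed.

End Functionals.

(** * The operator: from compactness to the molecule net, and bounds for [fhat] *)

Section Hat.
Variables (M N : Type) (dM : M -> M -> R) (dN : N -> N -> R).
Variables (oM : M) (oN : N) (f : M -> N).
Hypotheses (metM : is_metric dM) (metN : is_metric dN).
Hypotheses (lipf : lipschitz dM dN f) (f0 : f oM = oN).

(** Every sequence of molecules has a subsequence with convergent images, hence two terms whose
    images are within [e]; [finite_net_of_sequences] turns this into a finite net. *)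
Lemma compact_hat_molecule_net :
  compact_hat emb f dM oM dN oN -> molecule_net _ _ _ dM dN f.
Proof.
move=> comp e e0.
pose E (p q : M * M) := dnorm_le emb dN oN
  (dsub (fhat f (molecule _ dM q.1 q.2)) (fhat f (molecule _ dM p.1 p.2))) e.
have [u _|_ [n [c Hc]]] := @finite_net_of_sequences _ (fun _ _ => True) E.
  have [|| sigma [psi [sigma_lt [_ Hpsi]]]] :=
    comp (fun n => molecule _ dM (u n).1 (u n).2).
  - by move=> n; apply: molecule_in_free.
  - by move=> n; apply: molecule_norm.
  have [n0 Hn0] := Hpsi (e / 2) ltac:(lra).
  exists (sigma n0), (sigma n0.+1); split=> //; apply/dnorm_leP => g Hg.
  have /dnorm_leP/(_ g Hg) := Hn0 n0 (leqnn _).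
  have /dnorm_leP/(_ g Hg) := Hn0 n0.+1 (leqnSn _).
  rewrite /dsub => h1 h2.
  by apply: le_trans (nrm_dist_tri _ (psi g) _) _; rewrite [nrm (psi g - _)]nrm_distC; lra.
exists n, (fun i => (c i).1), (fun i => (c i).2) => x y _.
have [i /dnorm_leP Hi] := Hc (x, y) I; exists i => g Hg.
(* Subtracting [g oN] normalises the real test function at the base point and leaves its differences
   unchanged. *)
have /Hi : Lip0_ball emb dN oN (fun z => emb (g z - g oN)).
  apply/Lip0_ballP; split=> [|z w]; first by rewrite subrr rmorph0.
  by rewrite -rmorphB nrm_emb (_ : _ - _ = g z - g w) //; ring.
rewrite /dsub /fhat /molecule /= -!rmorphB -!rmorphM -rmorphB nrm_emb.
by congr (`|_| <= _); ring.
Qed.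

Lemma Lip0_comp g : Lip0 emb dN oN g -> Lip0 emb dM oM (fun x => g (f x)).
Proof.
have [L [L0 fL]] := lipf.
case/(Lip0P _ _ _ metN) => L' [L'0 g0 HL']; split; first by rewrite f0.
exists (L' * L) => x y; rewrite norm_le_emb; apply: le_trans (HL' _ _) _.
by rewrite -mulrA ler_pM2l.
Qed.

Lemma linear_fhat phi :
  linear_on_Lip0 _ dM oM phi -> linear_on_Lip0 _ dN oN (fhat f phi).
Proof.
by move=> lphi a b g h Hg Hh; rewrite /fhat lphi //; exact: Lip0_comp.
Qed.

(** Composition with [f] multiplies Lipschitz constants by at most [L]; [C = L + 1] is positive and
    can be divided by. *)
Lemma dnorm_fhat : exists2 C, 0 < C & forall phi c, linear_on_Lip0 _ dM oM phi ->
  dnorm_le emb dM oM phi c -> dnorm_le emb dN oN (fhat f phi) (c * C).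
Proof.
have [L [L0 fL]] := lipf; exists (L + 1); first by rewrite ltr_wpDl.
move=> phi c lphi Hphi; apply/dnorm_leP => g /Lip0_ballP[g0 Hg].
apply: (dual_bound _ dM oM) => //; [by rewrite ltr_wpDl | by rewrite f0 |].
move=> x y; apply: le_trans (Hg _ _) _; apply: le_trans (fL _ _) _.
by case: metM => d0 _ _ _; rewrite ler_wpM2r // lerDl.
Qed.

Lemma span_fhat m : in_span_delta emb dM oM m -> in_span_delta emb dN oN (fhat f m).
Proof.
move=> [n [a [xs Hm]]]; exists n, a, (f \o xs) => g Hg.
by rewrite /fhat Hm //; exact: Lip0_comp.
Qed.

Lemma free_fhat phi : in_free emb dM oM phi -> in_free emb dN oN (fhat f phi).
Proof.
move=> [[lphi [c Hc]] happ]; have [C C0 HC] := dnorm_fhat; split.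
  by split; [apply: linear_fhat | exists (c * C); apply: HC].
move=> e e0; have [|m Hm Hphi] := happ (e / C); first by rewrite divr_gt0.
exists (fhat f m); first exact: span_fhat.
rewrite -[e](divfK (lt0r_neq0 C0)).
by apply: (HC (dsub phi m)) => //; apply: linear_dsub => //; apply: linear_span.
Qed.

(** * Sufficiency, second half: the Arzela-Ascoli and Schauder arguments *)

Section Sufficiency.
Hypotheses (p1 : P1 dM dN oM f) (p2 : P2 dM dN f) (p3 : P3 dM dN oM f).

(* Total boundedness of the adjoint image of the unit ball of Lip_0(N): only
   the values on a finite net of the images of steep pairs matter. *)
Lemma Lip0_ball_colouring (eta : R) : 0 < eta ->
  exists (F : finType) (col : (N -> K) -> F), forall g h,
    Lip0_ball emb dN oN g -> Lip0_ball emb dN oN h -> col g = col h ->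
    forall x y, nrm ((g (f x) - h (f x)) - (g (f y) - h (f y))) <= 2 * eta * dM x y.
Proof.
move=> eta0; have [delta delta0 Hdelta] := p2 eta eta0.
have [dM0 dME dMC dMT] := metM; have [dN0 dNE dNC dNT] := metN.
have ed0 : 0 < eta * delta by exact: mulr_gt0.
(* Precision [eta * delta / 4] is spent three times per point: moving to the centre for [g],
   comparing colours there, and moving back for [h]. Two points cost [3 / 2 * (eta * delta)], within
   the allowed [2 * eta * dM x y]. *)
have [|F [c Hc]] := steep_pairs_net _ _ _ _ _ _ _ _ metM metN lipf f0 p3 p1
  eta (eta * delta / 4) eta0; first by lra.
pose B := \sum_i dN (c i) oN.
have [|C [kc Hkc]] := totally_bounded_colouring _ _ _ _ (eta * delta / 4)
  nrm_metric (K_ball_tb B); first by lra.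
have ballB g i : Lip0_ball emb dN oN g -> nrm (g (c i)) <= B.
  move=> /Lip0_ballP[g0 Hg]; apply: (@le_trans _ _ (dN (c i) oN)).
    by have := Hg (c i) oN; rewrite g0 subr0.
  by rewrite /B (bigD1 i) //= lerDl sumr_ge0.
exists {ffun F -> C}, (fun g => [ffun i => kc (g (c i))]) => g h Bg Bh /ffunP Egh.
have [/Lip0_ballP[g0 Hg] /Lip0_ballP[h0 Hh]] := (Bg, Bh).
have close z : (exists i, dN z (c i) < eta * delta / 4) ->
    nrm (g z - h z) <= 3 * (eta * delta / 4).
  move=> [i Hi]; have := Egh i; rewrite !ffunE => Ei.
  have := Hkc _ _ (ballB g i Bg) (ballB h i Bh) Ei.
  have := Hg z (c i); have := Hh (c i) z; rewrite [dN (c i) z]dNC.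
  have := nrm_dist_tri (g z) (g (c i)) (h z).
  have := nrm_dist_tri (g (c i)) (h (c i)) (h z); lra.
move=> x y; have [flat|steep] := leP (dN (f x) (f y)) (eta * dM x y).
  have -> : g (f x) - h (f x) - (g (f y) - h (f y)) =
    (g (f x) - g (f y)) - (h (f x) - h (f y)) by ring.
  by have := Hg (f x) (f y); have := Hh (f x) (f y);
     have := nrmB (g (f x) - g (f y)) (h (f x) - h (f y)); lra.
(* By (P2) a steep pair is more than [delta] apart, so a uniform error on its images is small
   relative to [dM x y]. *)
have lt_delta : delta < dM x y.
  rewrite ltNge; apply/negP => le_delta.
  have D0 : 0 < dM x y.
    apply: metric_gt0 => // Exy; move: steep.
    by rewrite Exy (dNE _ _).2 // (dME _ _).2 // mulr0 ltxx.
  by have := Hdelta x y D0 le_delta; rewrite leNgt steep.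
have hx := close _ (Hc x y steep).
have hy : nrm (g (f y) - h (f y)) <= 3 * (eta * delta / 4).
  by apply/close/(Hc y x); rewrite dMC dNC.
apply: le_trans (nrmB _ _) _.
have : eta * delta <= eta * dM x y by rewrite ler_pM2l // ltW.
lra.
Qed.

(** Schauder's argument: replacing [g] by the representative [G] of its colour costs [e / 4] for
    each functional, and the values at the finitely many representatives, bounded by [C], are
    coloured to within [e / 2]. *)
Lemma functional_colouring (e : R) : 0 < e ->
  exists (F : finType) (col : ((M -> K) -> K) -> F), forall phi psi,
    linear_on_Lip0 _ dM oM phi -> linear_on_Lip0 _ dM oM psi ->
    dnorm_le emb dM oM phi 1 -> dnorm_le emb dM oM psi 1 -> col phi = col psi ->
    dnorm_le emb dN oN (dsub (fhat f phi) (fhat f psi)) e.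
Proof.
move=> e0; have [|F [col Hcol]] := Lip0_ball_colouring (e / 8); first by lra.
have [C C0 HC] := dnorm_fhat.
have [|V [kc Hkc]] := totally_bounded_colouring _ _ _ _ (e / 2)
  nrm_metric (K_ball_tb C); first by lra.
have /choice[G HG] : forall v, exists G, (exists2 g, Lip0_ball emb dN oN g & col g = v) ->
    Lip0_ball emb dN oN G /\ col G = v.
  move=> v; have [[g Bg cg]|] := pselect (exists2 g, Lip0_ball emb dN oN g & col g = v).
    by exists g.
  by exists (fun=> 0).
exists {ffun F -> V}, (fun phi => [ffun v => kc (phi (fun x => G v (f x)))]).
move=> phi psi lphi lpsi nphi npsi /ffunP Ecol; apply/dnorm_leP => g Bg.
have [|BG cG] := HG (col g); first by exists g.
have near th : linear_on_Lip0 _ dM oM th -> dnorm_le emb dM oM th 1 ->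
    nrm (th (fun x => g (f x)) - th (fun x => G (col g) (f x))) <= e / 4.
  move=> lth nth; have [LBg LBG] := (Lip0_ball_Lip0 _ _ _ _ Bg, Lip0_ball_Lip0 _ _ _ _ BG).
  rewrite -(linearB _ dM oM _ _ _ lth); [|exact: Lip0_comp|exact: Lip0_comp].
  rewrite -[e / 4]mul1r; apply: (dual_bound _ dM oM) => //; first by lra.
    by rewrite f0; case: Bg => -> _; case: BG => -> _; rewrite subrr.
  move=> x y; have -> : e / 4 = 2 * (e / 8) by lra.
  exact: Hcol.
have bound th : linear_on_Lip0 _ dM oM th -> dnorm_le emb dM oM th 1 ->
    nrm (th (fun x => G (col g) (f x))) <= C.
  by move=> lth nth; have /dnorm_leP := HC th 1 lth nth; rewrite mul1r; apply.
have := Ecol (col g); rewrite !ffunE => Ek.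
have := Hkc _ _ (bound phi lphi nphi) (bound psi lpsi npsi) Ek.
have := near phi lphi nphi; have := near psi lpsi npsi; rewrite /dsub /fhat.
set a := phi _; set b := psi _; set a' := phi _; set b' := psi _ => h1 h2 h3.
have := nrm_dist_tri a a' b; have := nrm_dist_tri a' b' b.
rewrite [nrm (b' - b)]nrm_distC; lra.
Qed.

Lemma compact_hat_sufficient : compact_hat emb f dM oM dN oN.
Proof.
move=> phi phi_free phi_norm; have lphi n : linear_on_Lip0 _ dM oM (phi n).
  by case: (phi_free n) => -[].
have col k : exists (F : finType) (c : nat -> F), forall m n, c m = c n ->
    dnorm_le emb dN oN (dsub (fhat f (phi m)) (fhat f (phi n))) k.+1%:R^-1.
  have [|F [c Hc]] := functional_colouring k.+1%:R^-1; first by rewrite invr_gt0.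
  by exists F, (c \o phi) => m n Ec; apply: Hc.
have [sigma [sigma_lt Hsigma]] := diagonal_subsequence _
  (fun k => projT1 (cid (projT2 (cid (col k))))).
pose u n := fhat f (phi (sigma n)).
have lu n : linear_on_Lip0 _ dN oN (u n) by exact: linear_fhat.
have close k m n : (k <= m)%N -> (k <= n)%N ->
    dnorm_le emb dN oN (dsub (u m) (u n)) k.+1%:R^-1.
  by move=> km kn; apply: (projT2 (cid (projT2 (cid (col k))))); apply: Hsigma.
(* Completeness of the scalars gives the pointwise limit on Lip_0(N); outside it the value [0] is
   arbitrary. *)
have /choice[psi Hpsi] : forall g, exists l, Lip0 emb dN oN g ->
    converges_to (fun a b : K => nrm (a - b)) (fun n => u n g) l.
  move=> g; have [/(Lip0P _ _ _ metN)[L [L0 g0 HL]]|] := pselect (Lip0 emb dN oN g); last by exists 0.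
  have [|l Hl] := K_complete (fun n => u n g); last by exists l.
  move=> e e0; have [|k Hk] := inv_nat_lt _ (e / L); first by rewrite divr_gt0.
  exists k => m n km kn; move: Hk; rewrite ltr_pdivlMr // => Hk.
  apply: le_lt_trans Hk; apply: (dual_bound _ dN oN (dsub (u m) (u n))) => //.
    exact: linear_dsub.
  exact: close.
have lpsi : linear_on_Lip0 _ dN oN psi.
  move=> a b g h Hg Hh; apply/eqP; rewrite -subr_eq0; apply/eqP/nrm_eq0/eqP.
  rewrite eq_le nrm_ge0 andbT; apply/ler_addgt0Pr => e e0; rewrite add0r.
  (* The tolerance [e] is shared among three limits with weights [1], [nrm a] and [nrm b]. *)
  pose C := 1 + nrm a + nrm b.
  have C0 : 0 < C by have := nrm_ge0 a; have := nrm_ge0 b; rewrite /C; lra.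
  have eC : 0 < e / C by rewrite divr_gt0.
  have [n1 H1] := Hpsi _ (Lip0_lin _ _ _ a b g h Hg Hh) _ eC.
  have [n2 H2] := Hpsi _ Hg _ eC; have [n3 H3] := Hpsi _ Hh _ eC.
  pose n := maxn n1 (maxn n2 n3).
  have := H1 n (leq_maxl _ _); rewrite lu // => /ltW h1.
  have /ltW h2 : nrm (u n g - psi g) < e / C by apply: H2; rewrite !leq_max leqnn orbT.
  have /ltW h3 : nrm (u n h - psi h) < e / C by apply: H3; rewrite !leq_max leqnn !orbT.
  apply: le_trans (nrm_dist_tri _ (a * u n g + b * u n h) _) _; rewrite nrm_distC.
  have -> : a * u n g + b * u n h - (a * psi g + b * psi h) =
    a * (u n g - psi g) + b * (u n h - psi h) by ring.
  have -> : e = e / C + (nrm a * (e / C) + nrm b * (e / C)).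
    by rewrite -!mulrDl -{1}[e / C]mul1r -mulrDl addrA -/C mulrC divfK // gt_eqF.
  apply: lerD => //; apply: le_trans (nrmD _ _) _; rewrite !nrmM.
  by apply: lerD; rewrite ler_wpM2l ?nrm_ge0.
(* One index of [close] tends to infinity; the bound survives, uniformly on the unit ball. *)
have upsi k n : (k <= n)%N -> dnorm_le emb dN oN (dsub (u n) psi) k.+1%:R^-1.
  move=> kn; apply/dnorm_leP => g Bg; apply/ler_addgt0Pr => e e0.
  have [n1 H1] := Hpsi _ (Lip0_ball_Lip0 _ _ _ _ Bg) e e0.
  have h1 := H1 (maxn k n1) (leq_maxr _ _).
  have /dnorm_leP/(_ g Bg) h2 := close k n (maxn k n1) kn (leq_maxl _ _).
  apply: le_trans (nrm_dist_tri _ (u (maxn k n1) g) _) _.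
  by move: h1 h2; rewrite /dsub => h1 h2; apply: lerD; last exact: ltW.
exists sigma, psi; split=> //; split; last first.
  move=> e /inv_nat_lt[k Hk]; exists k => n kn; apply/dnorm_leP => g Bg.
  by have /dnorm_leP/(_ g Bg)/le_trans := upsi k n kn; apply; apply: ltW.
split.
  (* [psi] is within [1] of [u 0], whose norm is at most [C]. *)
  split=> //; have [C C0 HC] := dnorm_fhat; exists (C + 1); apply/dnorm_leP => g Bg.
  have /dnorm_leP/(_ g Bg) := HC _ _ (lphi (sigma 0%N)) (phi_norm _).
  have /dnorm_leP/(_ g Bg) := upsi 0%N 0%N (leqnn _); rewrite mul1r invr1 /dsub -/(u 0%N).
  have := nrmB (u 0%N g) (u 0%N g - psi g).
  by rewrite (_ : u 0%N g - (u 0%N g - psi g) = psi g); [lra | ring].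
(* Half of [e] goes from [psi] to [u k], the other half from [u k] to a finite combination of
   evaluations. *)
move=> e e0; have [|k Hk] := inv_nat_lt _ (e / 2); first by lra.
have [_ /(_ (e / 2))[|m Hm Hum]] := free_fhat _ (phi_free (sigma k)); first by lra.
exists m => //; apply/dnorm_leP => g Bg.
have /dnorm_leP/(_ g Bg) h1 := upsi k k (leqnn _).
have h2 : nrm (u k g - m g) <= e / 2 by move/dnorm_leP/(_ g Bg): Hum.
apply: le_trans (nrm_dist_tri _ (u k g) _) _; rewrite [nrm (psi g - _)]nrm_distC.
have -> : e = e / 2 + e / 2 by lra.
by apply: lerD => //; apply: le_trans h1 (ltW Hk).
Qed.

End Sufficiency.

Lemma compact_hat_iff : complete_metric dN ->
  compact_hat emb f dM oM dN oN <->
  [/\ P1 dM dN oM f, P2 dM dN f & P3 dM dN oM f].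
Proof.
move=> complN; split=> [/compact_hat_molecule_net net|[]]; last exact: compact_hat_sufficient.
split.
- exact: molecule_net_P1 net.
- exact: molecule_net_P2 net lipf.
- exact: molecule_net_P3 net complN.
Qed.

End Hat.
End Operator.

(** * The real and complex cases as instances of the abstract scalar field *)

Theorem theoremA (R : realType) (M N : Type)
  (dM : M -> M -> R) (oM : M) (dN : N -> N -> R) (oN : N) (f : M -> N) :
  is_metric dM -> complete_metric dM ->
  is_metric dN -> complete_metric dN ->
  lipschitz dM dN f -> f oM = oN ->
  (* real scalars *)
  (compact_hat (fun r : R => r) f dM oM dN oN <->
     [/\ P1 dM dN oM f, P2 dM dN f & P3 dM dN oM f]) /\
  (* complex scalars *)
  (compact_hat (@real_to_complex R) f dM oM dN oN <->
     [/\ P1 dM dN oM f, P2 dM dN f & P3 dM dN oM f]).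
Proof.
move=> metM _ metN complN lipf f0; split.
- apply: (@compact_hat_iff R R (idfun : {rmorphism R -> R}) Num.norm) => //.
  + exact: real_complete.
  + exact: real_ball_totally_bounded.
- apply: (@compact_hat_iff R R[i] (real_complex R : {rmorphism R -> R[i]}) (@nrmC R)) => //.
  + exact: lecR.
  + exact: normc_def.
  + exact: complex_complete.
  + exact: complex_ball_totally_bounded.
Qed.
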